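(* The Fuglede conjecture holds in $\mathbb{Z}_2^3$ and in $\mathbb{Z}_3^3$; that is, for $p\in\{2,3\}$, a nonempty subset $E\subseteq\mathbb{Z}_p^3$ is spectral if and only if it tiles $\mathbb{Z}_p^3$ by translation.
   Context: $\mathbb{Z}_p=\mathbb{Z}/p\mathbb{Z}$, $x\cdot y=\sum_i x_iy_i$ on $\mathbb{Z}_p^3$, and $\chi(u)=e^{2\pi i u/p}$. $E\subseteq\mathbb{Z}_p^3$ tiles if there is $A\subseteq\mathbb{Z}_p^3$ such that the translates $E+a$, $a\in A$, partition $\mathbb{Z}_p^3$. $E\subseteq\mathbb{Z}_p^3$ is spectral if there is $B\subseteq\mathbb{Z}_p^3$ such that the functions $x\mapsto\chi(b\cdot x)$, indexed by $b\in B$, form an orthogonal basis of $L^2(E)$, the space of functions $E\to\mathbb{C}$ with inner product $\langle f,g\rangle=\sum_{e\in E}f(e)\overline{g(e)}$. *)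

(* Defs.v *)
From HB Require Import structures.
From mathcomp Require Import all_boot all_order all_algebra.
From mathcomp Require Import complex.
From mathcomp Require Import reals trigo.

Set Implicit Arguments.
Unset Strict Implicit.
Unset Printing Implicit Defensive.

Import Order.TTheory GRing.Theory Num.Theory.

Local Open Scope ring_scope.

(* 'Z_p is the ring of integers mod p only for 1 < p. *)
Definition Zp3 (p : nat) := 'rV['Z_p]_3.

Definition dot (p : nat) (x y : Zp3 p) : 'Z_p := \sum_(i < 3) x 0 i * y 0 i.

Definition translate (p : nat) (E : {set Zp3 p}) (a : Zp3 p) : {set Zp3 p} :=
  [set x + a | x in E].

(* The translates form a family indexed by A: injectivity excludes using the
   same translate for two different elements of A. *)
Definition tiles (p : nat) (E : {set Zp3 p}) : Prop :=
  exists A : {set Zp3 p},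
    {in A &, injective (translate E)} /\
    partition [set translate E a | a in A] [set: Zp3 p].

Definition expi (R : realType) (t : R) : R[i] := Complex (cos t) (sin t).

(* u is read as its representative in [0, p); the value does not depend on the
   choice of representative. *)
Definition chi (R : realType) (p : nat) (u : 'Z_p) : R[i] :=
  expi (2 * pi * (u : nat)%:R / p%:R).

(* R[i]^o is R[i] as a vector space over itself, which makes L2 R E a
   finite-dimensional vector space over R[i]. *)
Definition L2 (R : realType) (p : nat) (E : {set Zp3 p}) :=
  {ffun {x : Zp3 p | x \in E} -> R[i]^o}.

Definition inner (R : realType) (p : nat) (E : {set Zp3 p}) (f g : L2 R E) :
    R[i] :=
  \sum_(e : {x : Zp3 p | x \in E}) (f e : R[i]) * conjc (g e : R[i]).

Definition character (R : realType) (p : nat) (E : {set Zp3 p}) (b : Zp3 p) :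
    L2 R E :=
  [ffun x : {x : Zp3 p | x \in E} => chi R (dot b (val x))].

(* basis_of is applied to the family indexed by B (enum B is duplicate-free), so
   it forces distinct elements of B to give distinct functions on E. *)
Definition spectral (R : realType) (p : nat) (E : {set Zp3 p}) : Prop :=
  exists B : {set Zp3 p},
    {in B &, forall b c, b != c -> inner (character R E b) (character R E c) = 0}
    /\ basis_of (fullv : {vspace L2 R E}) [seq character R E b | b <- enum B].

(* Main.v *)
Require Import Defs.
From mathcomp Require Import all_boot all_order all_algebra.
From mathcomp Require Import complex.
From mathcomp Require Import reals trigo.
From mathcomp Require Import zify lra.

(** Let [Z] be the set of frequencies at which the Fourier transform of the
    indicator function of [E] vanishes, together with the origin. Spectrality
    and tiling are both equivalent to a third property: some subgroup [W]
    contained in [Z] has exactly [#|E|] elements ([group_spectrum]).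

    Such a [W] is itself a spectrum of [E]. By Poisson summation
    ([equidistribution]) [E] also has exactly one point in each coset of the
    annihilator of [W], so that it tiles with this annihilator. For any subgroup
    [W] in [Z], the same formula gives [#|W| * m = #|E|], where [m] is the number
    of points in each coset. As [#|W|] is a power of [p], a subgroup of [Z] with
    more than [p ^ k] elements forces [p ^ k.+1] to divide [#|E|]; it has the
    right size if moreover [#|E| <= p ^ k.+1] ([group_spectrum_of_card]).

    From a spectrum [B], the differences of which are in [Z], the subgroup comes
    from pigeonhole arguments. If [1 < #|E| <= p], the line through a difference
    of [B] is enough. If [p < #|E| <= p ^ 2], then [#|E| >= 2 * p] since [p]
    divides [#|E|]. The inequality [2 * p * (2 * p - 1) >= p ^ 3], true for [p]
    equal to [2] or [3], makes two ordered pairs of [B] have the same nonzero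
    difference, and the resulting configuration shows that all the lines of some
    plane are in [Z] ([plane_of_differences]). If [#|E| > p ^ 2], every direction
    is that of a difference of [B], and [Z] is the whole space.

    From a tiling of [E] by [A], the product of the two Fourier transforms
    vanishes off the origin, and [#|E| * #|A| = p ^ 3]. The sizes [1] and
    [p ^ 3] of [E] are immediate. If [#|E| = p], some
    frequency other than the origin is in [Z], since otherwise [p ^ 3] would
    divide [#|A|]; it spans [W]. If [#|E| = p ^ 2], let [a] and [b] be two
    points of [A]. The characters orthogonal to [a - b] agree at [a] and [b], so
    their sum over the at most three points of [A] is not zero ([fourier_neq0]),
    and the plane orthogonal to [a - b] is in [Z]. *)

Import Order.TTheory GRing.Theory Num.Theory.

Local Open Scope ring_scope.

(** * Characters of the space *)

Lemma expiD {R : realType} (s t : R) : expi (s + t) = expi s * expi t.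
Proof.
rewrite /expi cosD sinD; apply/eqP.
by rewrite eq_complex /= [sin s * _ + _]addrC !eqxx.
Qed.

Lemma expi2pi {R : realType} (n : nat) : expi (2 * pi * n%:R : R) = 1.
Proof.
elim: n => [|n IH]; first by rewrite mulr0 /expi cos0 sin0.
rewrite -[n.+1]addn1 (natrD _ n) (mulrDr (2 * pi)) mulr1 expiD IH mul1r.
by rewrite /expi mulr_natl cos2pi sin2pi.
Qed.

Lemma chiD {R : realType} {p : nat} (p_gt1 : (1 < p)%N) (u v : 'Z_p) :
  chi R (u + v) = chi R u * chi R v.
Proof.
have p_neq0 : p%:R != 0 :> R by rewrite pnatr_eq0; lia.
rewrite /chi -expiD -mulrDl -mulrDr -natrD.
set n := (u + v)%N; have -> : n = (n %/ p * p + n %% p)%N by exact: divn_eq.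
rewrite (natrD _ (n %/ p * p)) (mulrDr (2 * pi)) (mulrDl (2 * pi * _)) expiD.
rewrite natrM mulrA mulfK // expi2pi mul1r.
by congr (expi (_ * _%:R / _)); exact: (congr1 (modn n) (Zp_cast p_gt1)).
Qed.

Lemma chi0 {R : realType} {p : nat} : chi R (0 : 'Z_p) = 1.
Proof. by rewrite /chi /= mulr0 mul0r /expi cos0 sin0. Qed.

Lemma normr_chi {R : realType} {p : nat} (u : 'Z_p) : `|chi R u| = 1.
Proof. by rewrite normc_def /= cos2Dsin2 sqrtr1. Qed.

Lemma chiN {R : realType} {p : nat} (p_gt1 : (1 < p)%N) (u : 'Z_p) :
  chi R (- u) = conjc (chi R u).
Proof.
have chiVchi : chi R (- u) * chi R u = 1 by rewrite -chiD // addNr chi0.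
by rewrite -[RHS]mul1r -chiVchi -mulrA -sqr_normc normr_chi expr1n mulr1.
Qed.

(** The half angle [pi * u / p] lies strictly between [0] and [pi], so its sine
    does not vanish and the cosine of the full angle is not [1]. *)
Lemma chi_neq1 {R : realType} {p : nat} (p_gt1 : (1 < p)%N) (u : 'Z_p) :
  u != 0 -> chi R u != 1.
Proof.
move=> u_neq0; have p_gt0 : 0 < p%:R :> R by rewrite ltr0n; lia.
have u_gt0 : (0 < u)%N by rewrite lt0n.
have u_lt : (u < p)%N := leq_trans (ltn_ord u) (eq_leq (Zp_cast p_gt1)).
set t : R := pi * u%:R / p%:R.
have sint : 0 < sin t.
  rewrite sin_gt0_pi // divr_gt0 ?mulr_gt0 ?pi_gt0 ?ltr0n //; last by lia.
  by rewrite /= ltr_pdivrMr // ltr_pM2l ?pi_gt0 // ltr_nat.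
apply/eqP => /(congr1 (@complex.Re R)) /=.
have -> : 2 * pi * u%:R / p%:R = t *+ 2 by rewrite -!mulrA mulr_natl mulrA.
rewrite cos_mulr2n cos2sin2 => e.
have : sin t ^+ 2 = 0 by lra.
by move/eqP; rewrite expf_eq0 /= gt_eqF.
Qed.

Lemma dotC {p : nat} (x y : Zp3 p) : dot x y = dot y x.
Proof. by apply: eq_bigr => i _; rewrite mulrC. Qed.

Lemma dotDl {p : nat} (x y z : Zp3 p) : dot (x + y) z = dot x z + dot y z.
Proof. by rewrite -big_split; apply: eq_bigr => i _; rewrite mxE mulrDl. Qed.

Lemma dotNl {p : nat} (x z : Zp3 p) : dot (- x) z = - dot x z.
Proof. by rewrite -sumrN; apply: eq_bigr => i _; rewrite mxE mulNr. Qed.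

Lemma dotBl {p : nat} (x y z : Zp3 p) : dot (x - y) z = dot x z - dot y z.
Proof. by rewrite dotDl dotNl. Qed.

Lemma dotBr {p : nat} (x y z : Zp3 p) : dot x (y - z) = dot x y - dot x z.
Proof. by rewrite !(dotC x) dotBl. Qed.

Lemma dot0l {p : nat} (z : Zp3 p) : dot 0 z = 0.
Proof. by rewrite -(subrr 0) dotBl subrr. Qed.

Lemma dot_nondegenerate {p : nat} (x : Zp3 p) :
  (forall w, dot w x = 0) -> x = 0.
Proof.
move=> x0; apply/rowP => i; have := x0 (delta_mx 0 i).
rewrite /dot (bigD1 i) //= big1 => [|j ji]; last by rewrite mxE (negPf ji) mul0r.
by rewrite !mxE !eqxx mul1r addr0.
Qed.

Lemma card_Zp3 {p : nat} (p_gt1 : (1 < p)%N) : #|[set: Zp3 p]| = (p ^ 3)%N.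
Proof. by rewrite cardsT card_mx card_ord Zp_cast. Qed.

Definition annihilator {p : nat} (W : {set Zp3 p}) : {set Zp3 p} :=
  [set x | [forall w in W, dot w x == 0]].

Lemma annihilator_zmod_closed {p : nat} (W : {set Zp3 p}) :
  zmod_closed (annihilator W).
Proof.
split=> [|x y]; rewrite !inE.
  by apply/forall_inP => w _; rewrite dotC dot0l.
move=> /forall_inP hx /forall_inP hy; apply/forall_inP => w wW.
by rewrite dotBr (eqP (hx w wW)) (eqP (hy w wW)) subrr.
Qed.

Lemma setT_zmod_closed {V : finZmodType} : zmod_closed [set: V].
Proof. by split=> [|x y _ _]; rewrite inE. Qed.

Lemma annihilatorT {p : nat} (x : Zp3 p) :
  (x \in annihilator [set: Zp3 p]) = (x == 0).
Proof.
rewrite inE; apply/forall_inP/eqP => [h|-> w _]; last by rewrite dotC dot0l.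
by apply: dot_nondegenerate => w; apply/eqP/h; rewrite inE.
Qed.

(** Translating the summation variable by some [w0] of [W] with [dot w0 x <> 0]
    multiplies the sum by the number [chi (dot w0 x)], which differs from [1]. *)
Lemma sum_chi_subgroup {R : realType} {p : nat} (p_gt1 : (1 < p)%N)
    (W : {set Zp3 p}) (x : Zp3 p) : zmod_closed W ->
  \sum_(w in W) chi R (dot w x) = (#|W| * (x \in annihilator W))%:R.
Proof.
move=> W_zmod; have [_ WB] := W_zmod; have [_ WD] := GRing.zmod_closedD W_zmod.
rewrite inE; case: forall_inP => [xW|].
  rewrite muln1 (eq_bigr (fun=> 1)) ?sumr_const // => w wW.
  by rewrite (eqP (xW w wW)) chi0.
move=> /forall_inP; rewrite negb_forall_in => /exists_inP[w0 w0W w0x].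
rewrite muln0; set S := \sum_(w in W) _.
suff : S = chi R (dot w0 x) * S.
  move/eqP; rewrite -subr_eq0 -{1}[S]mul1r -mulrBl mulf_eq0 subr_eq0 eq_sym.
  by rewrite (negPf (chi_neq1 p_gt1 _ w0x)) => /eqP.
rewrite {1}/S (reindex_inj (addrI w0)) mulr_sumr.
apply: eq_big => [w|w _]; last by rewrite dotDl chiD.
apply/idP/idP => [h|wW]; last exact: WD.
by rewrite -[w](addKr w0) addrC; apply: WB.
Qed.

(** Sum [chi (dot w x)] over [w] in [W] and all [x]: summing over [w] first
    leaves the [x] of the annihilator, summing over [x] first leaves [w = 0]. *)
Lemma card_annihilator (R : realType) {p : nat} (p_gt1 : (1 < p)%N)
    (W : {set Zp3 p}) :
  zmod_closed W -> (#|W| * #|annihilator W|)%N = (p ^ 3)%N.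
Proof.
move=> W_zmod; have W0 : 0 \in W by case: W_zmod.
pose S : R[i] := \sum_(x in [set: Zp3 p]) \sum_(w in W) chi R (dot w x).
have S1 : S = (#|W| * #|annihilator W|)%:R.
  rewrite /S (eq_bigr (fun x => (#|W| * (x \in annihilator W))%:R)); last first.
    by move=> x _; exact: sum_chi_subgroup.
  rewrite -natr_sum -big_distrr /=; congr (_ * _)%:R.
  rewrite -sum1_card big_mkcond [RHS]big_mkcond.
  by apply: eq_bigr => x _; rewrite in_setT; case: ifP.
have S2 : S = (p ^ 3)%:R.
  rewrite /S exchange_big (bigD1 0) //= [X in _ + X]big1 => [|w /andP[_ w0]].
    rewrite addr0 (eq_bigr (fun=> 1)) => [|x _]; last by rewrite dot0l chi0.
    by rewrite sumr_const card_Zp3.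
  under eq_bigr => x _ do rewrite dotC.
  rewrite sum_chi_subgroup //; last exact: setT_zmod_closed.
  by rewrite annihilatorT (negPf w0) muln0.
by apply/eqP; rewrite -(eqr_nat R[i]) -S1 S2.
Qed.

(** * Spectra as sets of zeros of the Fourier transform *)

Definition fourier (R : realType) {p : nat} (E : {set Zp3 p}) (xi : Zp3 p) :
    R[i] :=
  \sum_(x in E) chi R (dot xi x).

Lemma fourierN {R : realType} {p : nat} (p_gt1 : (1 < p)%N) (E : {set Zp3 p})
    (xi : Zp3 p) : fourier R E (- xi) = conjc (fourier R E xi).
Proof.
by rewrite /fourier rmorph_sum /=; apply: eq_bigr => x _; rewrite dotNl chiN.
Qed.

Lemma fourier0 {R : realType} {p : nat} (E : {set Zp3 p}) :
  fourier R E 0 = #|E|%:R.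
Proof.
rewrite /fourier (eq_bigr (fun=> 1)) ?sumr_const // => x _.
by rewrite dot0l chi0.
Qed.

Lemma inner_character {R : realType} {p : nat} (p_gt1 : (1 < p)%N)
    (E : {set Zp3 p}) (b c : Zp3 p) :
  inner (character R E b) (character R E c) = fourier R E (b - c).
Proof.
rewrite /fourier big_sub; apply: eq_bigr => x _.
by rewrite !ffunE dotBl chiD // chiN.
Qed.

Lemma inner_suml {R : realType} {p : nat} (E : {set Zp3 p}) (n : nat)
    (k : 'I_n -> R[i]) (f : 'I_n -> L2 R E) (g : L2 R E) :
  inner (\sum_i k i *: f i) g = \sum_i k i * inner (f i) g.
Proof.
rewrite /inner; under [RHS]eq_bigr => i _ do rewrite mulr_sumr.
rewrite exchange_big; apply: eq_bigr => e _ /=.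
rewrite sum_ffunE mulr_suml; apply: eq_bigr => i _.
by rewrite ffunE -mulrA.
Qed.

Lemma dim_L2 {R : realType} {p : nat} (E : {set Zp3 p}) :
  \dim (fullv : {vspace L2 R E}) = #|E|.
Proof.
rewrite dimvf /dim /= card_sig (_ : dim _ = 1%N) ?muln1 //.
Qed.

(** Orthogonal characters are linearly independent, so they form a basis as soon
    as there are [#|E|] of them. *)
Lemma spectral_fourier {R : realType} {p : nat} (p_gt1 : (1 < p)%N)
    (E : {set Zp3 p}) (E_neq0 : E != set0) :
  spectral R E <->
  exists2 B : {set Zp3 p}, #|B| = #|E|
    & {in B &, forall b c, b != c -> fourier R E (b - c) = 0}.
Proof.
split=> [[B [B_orth B_basis]]|[B cardB B_zero]]; exists B.
- have := B_basis; rewrite basisEfree subvf dim_L2.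
  rewrite size_map -cardE => /and3P[/eqP + _ _].
  by rewrite (span_basis B_basis) dim_L2 size_map -cardE => <-.
- by move=> b c bB cB bc; rewrite -inner_character // B_orth.
split=> [b c bB cB bc|]; first by rewrite inner_character // B_zero.
rewrite basisEfree subvf dim_L2 size_map -cardE cardB leqnn !andbT.
set X := [seq _ | b <- _].
have inner_nth (i j : 'I_(size X)) :
    inner X`_i X`_j = ((i == j)%:R * #|E|%:R : R[i]).
  have lt_enum (l : 'I_(size X)) : (l < size (enum B))%N.
    by apply: leq_trans (ltn_ord l) _; rewrite size_map.
  rewrite !(nth_map 0) // inner_character //.
  case: eqVneq => [->|ij]; first by rewrite subrr fourier0 mul1r.
  have nthB (l : 'I_(size X)) : nth 0 (enum B) l \in B.
    by rewrite -mem_enum mem_nth.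
  rewrite mul0r; apply: B_zero; [exact: nthB|exact: nthB|].
  by rewrite (nth_uniq 0 (lt_enum i) (lt_enum j) (enum_uniq B)).
apply/(@freeP _ _ _ (in_tuple X)) => k k0 j.
have := inner_suml E _ k (fun i => X`_i) X`_j; rewrite k0 => /esym.
rewrite (bigD1 j) //= inner_nth eqxx mul1r big1 => [|i ij]; last first.
  by rewrite inner_nth (negPf ij) mul0r mulr0.
rewrite addr0 /inner big1 => [/eqP|e _]; last by rewrite ffunE mul0r.
by rewrite mulf_eq0 pnatr_eq0 cards_eq0 (negPf E_neq0) orbF => /eqP.
Qed.

(** The zeros of the Fourier transform of the indicator function of [E]. The
    origin is added so that subgroups can be compared with this set. *)
Definition zeros (R : realType) {p : nat} (E : {set Zp3 p}) : {set Zp3 p} :=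
  [set xi | (xi == 0) || (fourier R E xi == 0)].

Lemma zeros0 {R : realType} {p : nat} (E : {set Zp3 p}) : 0 \in zeros R E.
Proof. by rewrite inE eqxx. Qed.

Lemma zerosN {R : realType} {p : nat} (p_gt1 : (1 < p)%N) (E : {set Zp3 p})
    (xi : Zp3 p) : (- xi \in zeros R E) = (xi \in zeros R E).
Proof. by rewrite !inE fourierN // conjc_eq0 oppr_eq0. Qed.

(** The property through which spectrality and tiling are compared: [E] has a
    spectrum that is a subgroup. *)
Definition group_spectrum (R : realType) {p : nat} (E W : {set Zp3 p}) : Prop :=
  [/\ zmod_closed W, W \subset zeros R E & #|W| = #|E|].

(** Poisson summation over [W]: expand the number of points of [E] in the coset
    [x + annihilator W] by the characters of [W]; only the trivial one has a
    nonzero contribution, so [E] is equidistributed over these cosets. *)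
Lemma equidistribution (R : realType) {p : nat} (p_gt1 : (1 < p)%N)
    (E W : {set Zp3 p}) (x : Zp3 p) :
  zmod_closed W -> W \subset zeros R E ->
  (#|W| * #|[set e in E | (x - e)%R \in annihilator W]|)%N = #|E|.
Proof.
move=> W_zmod W_zeros; have W0 : 0 \in W by case: W_zmod.
pose S : R[i] := \sum_(e in E) \sum_(w in W) chi R (dot w (x - e)).
have S1 : S = (#|W| * #|[set e in E | (x - e)%R \in annihilator W]|)%:R.
  rewrite /S; under eq_bigr => e _ do rewrite sum_chi_subgroup //.
  rewrite -natr_sum -big_distrr /=; congr (_ * _)%:R.
  rewrite -sum1_card big_mkcond [RHS]big_mkcond.
  by apply: eq_bigr => e _; rewrite inE; case: (e \in E) => //=; case: ifP.
have S2 : S = #|E|%:R.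
  rewrite /S exchange_big (bigD1 0) //= [X in _ + X]big1 => [|w /andP[wW w0]].
    rewrite addr0 (eq_bigr (fun=> 1)) => [|e _]; last by rewrite dot0l chi0.
    by rewrite sumr_const.
  have := subsetP W_zeros _ wW; rewrite -(zerosN p_gt1) inE oppr_eq0 (negPf w0).
  move=> /= /eqP E_w.
  rewrite (eq_bigr (fun e => chi R (dot w x) * chi R (dot (- w) e))).
    by rewrite -mulr_sumr -/(fourier R E (- w)) E_w mulr0.
  by move=> e _; rewrite dotNl -chiD // dotBr.
by apply/eqP; rewrite -(eqr_nat R[i]) -S1 S2.
Qed.

Lemma card_subgroup_dvd (R : realType) {p : nat} (p_gt1 : (1 < p)%N)
    (E W : {set Zp3 p}) :
  zmod_closed W -> W \subset zeros R E -> (#|W| %| #|E|)%N.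
Proof.
by move=> W_zmod WE; rewrite -(equidistribution R p_gt1 E W 0) ?dvdn_mulr.
Qed.

(** The order of [W] divides [p ^ 3], hence is a power of [p]. *)
Lemma dvdn_card_subgroup (R : realType) {p : nat} (p_pr : prime p) (k : nat)
    (W : {set Zp3 p}) :
  zmod_closed W -> (p ^ k < #|W|)%N -> (p ^ k.+1 %| #|W|)%N.
Proof.
move=> W_zmod; have := card_annihilator R (prime_gt1 p_pr) W W_zmod.
move/(congr1 (dvdn #|W|)); rewrite dvdn_mulr // => /esym/(dvdn_pfactor _ _ p_pr).
case=> m _ ->; rewrite ltn_exp2l ?prime_gt1 //; exact: dvdn_exp2l.
Qed.

(** [#|W|] is at least [p ^ k.+1] because it is a power of [p], and at most
    [#|E|] because it divides [#|E|]. *)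
Lemma group_spectrum_of_card {R : realType} {p : nat} (p_pr : prime p) (k : nat)
    (E W : {set Zp3 p}) : E != set0 ->
  zmod_closed W -> W \subset zeros R E -> (p ^ k < #|W|)%N ->
  (#|E| <= p ^ k.+1)%N -> group_spectrum R E W.
Proof.
move=> E0 W_zmod WE W_gt E_le; split=> //; apply/eqP.
have E_gt0 : (0 < #|E|)%N by rewrite card_gt0.
have dvdW := card_subgroup_dvd R (prime_gt1 p_pr) E W W_zmod WE.
rewrite eqn_leq dvdn_leq //=; apply: leq_trans E_le _.
apply: dvdn_leq; first exact: leq_ltn_trans W_gt.
exact: (dvdn_card_subgroup R).
Qed.

Lemma group_spectrum1 {R : realType} {p : nat} (E : {set Zp3 p}) :
  #|E| = 1%N -> group_spectrum R E [set 0].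
Proof.
move=> E1; split; last by rewrite cards1.
  by split=> [|x y]; rewrite !inE // => /eqP-> /eqP->; rewrite subrr.
by rewrite sub1set zeros0.
Qed.

Lemma spectral_of_group_spectrum {R : realType} {p : nat} (p_gt1 : (1 < p)%N)
    (E : {set Zp3 p}) (E_neq0 : E != set0) (W : {set Zp3 p}) :
  group_spectrum R E W -> spectral R E.
Proof.
move=> [[_ WB] WE cardW]; apply/spectral_fourier => //; exists W => // b c bW cW.
have := subsetP WE _ (WB _ _ bW cW); rewrite inE subr_eq0.
by case: eqP => //= _ /eqP.
Qed.

Lemma tiles_of_unique {p : nat} (E A : {set Zp3 p}) : E != set0 ->
  (forall x, #|[set e in E | (x - e) \in A]| = 1%N) -> tiles E.
Proof.
move=> /set0Pn[e0 e0E] EA1; exists A.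
have in_translate a x : a \in A -> x \in translate E a ->
    exists2 e, [set e in E | (x - e) \in A] = [set e] & x = e + a.
  move=> aA /imsetP[e eE xe]; exists e => //.
  have /eqP/cards1P[e' e'P] := EA1 x; rewrite e'P.
  have : e \in [set e in E | (x - e) \in A] by rewrite inE eE xe addrC addKr.
  by rewrite e'P inE => /eqP->.
have translate_eq a b x : a \in A -> b \in A ->
    x \in translate E a -> x \in translate E b -> a = b.
  move=> aA bA /(in_translate _ _ aA)[e ee xe] /(in_translate _ _ bA)[f].
  rewrite ee => /set1_inj <-; rewrite xe => /addrI; exact.
have translate_e0 a : e0 + a \in translate E a by apply: imset_f.
split=> [a b aA bA ab|].
  by apply: (translate_eq _ _ (e0 + a)); rewrite -?ab.
apply/and3P; split.
- apply/eqP/setP => x; rewrite inE; apply/bigcupP.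
  have /eqP/cards1P[e /setP/(_ e)] := EA1 x; rewrite !inE eqxx => /andP[eE xeA].
  exists (translate E (x - e)); first exact: imset_f.
  by apply/imsetP; exists e; rewrite // addrC subrK.
- apply/trivIsetP => _ _ /imsetP[a aA ->] /imsetP[b bA ->]; apply: contraNT.
  by move=> /pred0Pn[x /andP[xa xb]]; rewrite (translate_eq a b x).
- by apply/imsetP => -[a aA /setP/(_ (e0 + a))]; rewrite inE translate_e0.
Qed.

(** When [#|W| = #|E|], equidistribution leaves one point of [E] in each coset of
    the annihilator. *)
Lemma tiles_of_group_spectrum {R : realType} {p : nat} (p_gt1 : (1 < p)%N)
    (E : {set Zp3 p}) (E_neq0 : E != set0) (W : {set Zp3 p}) :
  group_spectrum R E W -> tiles E.
Proof.
move=> [W_zmod WE cardW]; apply: (tiles_of_unique E (annihilator W)) => // x.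
apply/eqP; rewrite -(eqn_pmul2l (m := #|W|)) ?muln1.
  by rewrite (equidistribution R) // cardW.
by rewrite cardW card_gt0.
Qed.

(** * From a spectrum to a subgroup of zeros *)

Definition span2 {p : nat} (u v : Zp3 p) : {set Zp3 p} :=
  [set s *: u + t *: v | s in [set: 'Z_p], t in [set: 'Z_p]].

Lemma mem_span2 {p : nat} (u v : Zp3 p) (s t : 'Z_p) :
  s *: u + t *: v \in span2 u v.
Proof. by apply/imset2P; exists s t. Qed.

Lemma span2_zmod_closed {p : nat} (u v : Zp3 p) : zmod_closed (span2 u v).
Proof.
split=> [|_ _ /imset2P[s t _ _ ->] /imset2P[s' t' _ _ ->]].
  by rewrite -[0]addr0 -{1}(scale0r u) -(scale0r v) mem_span2.
by rewrite opprD addrACA -!scalerBl mem_span2.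
Qed.

Lemma mem_span2l {p : nat} (u v : Zp3 p) : u \in span2 u v.
Proof. by have := mem_span2 u v 1 0; rewrite scale1r scale0r addr0. Qed.

Lemma scalar_cases {p : nat} (hp : p = 2%N \/ p = 3%N) (s : 'Z_p) :
  [\/ s = 0, s = 1 | s = -1].
Proof.
case: hp s => -> [[|[|[|m]]] lt_m]; by
  [constructor 1; apply: val_inj | constructor 2; apply: val_inj
  | constructor 3; apply: val_inj | case: (notF lt_m)].
Qed.

Lemma scaler_inj {p : nat} (hp : p = 2%N \/ p = 3%N) (u : Zp3 p) : u != 0 ->
  injective (fun s : 'Z_p => s *: u).
Proof.
move=> u0 s t /eqP; rewrite -subr_eq0 -scalerBl => /eqP st.
apply/eqP; rewrite -subr_eq0; apply/eqP; move: u0 st.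
case: (scalar_cases hp (s - t)) => -> // /negP u0.
  by rewrite scale1r => /eqP/u0.
by rewrite scaleN1r => /eqP; rewrite oppr_eq0 => /u0.
Qed.

(** The lines of the plane spanned by [u] and [v] are those of [u], [v], [u + v]
    and [u - v], because the only scalars are [0], [1] and [-1]. *)
Lemma span2_sub_zeros {R : realType} {p : nat} (hp : p = 2%N \/ p = 3%N)
    (E : {set Zp3 p}) (u v : Zp3 p) :
  u \in zeros R E -> v \in zeros R E -> u + v \in zeros R E ->
  u - v \in zeros R E -> span2 u v \subset zeros R E.
Proof.
have p_gt1 : (1 < p)%N by lia.
move=> uE vE uvE uNvE; apply/subsetP => _ /imset2P[s t _ _ ->].
case: (scalar_cases hp s) => ->; case: (scalar_cases hp t) => ->;
  rewrite ?scaleN1r ?scale1r ?scale0r ?add0r ?addr0 -?opprD ?zerosN ?zeros0 //.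
by rewrite -(zerosN p_gt1) opprD opprK.
Qed.

Lemma card_span2_gt1 {p : nat} (u v : Zp3 p) : u != 0 -> (1 < #|span2 u v|)%N.
Proof.
move=> u0; have [z0 _] := span2_zmod_closed u v.
by apply/card_gt1P; exists 0, u; split; rewrite // ?mem_span2l // eq_sym.
Qed.

Lemma card_scalars {p : nat} (p_gt1 : (1 < p)%N) : #|[set: 'Z_p]| = p.
Proof. by rewrite cardsT card_ord Zp_cast. Qed.

Lemma card_line {p : nat} (hp : p = 2%N \/ p = 3%N) (u : Zp3 p) : u != 0 ->
  #|[set s *: u | s in [set: 'Z_p]]| = p.
Proof.
move=> u0; rewrite card_imset; last exact: scaler_inj.
by rewrite card_scalars //; lia.
Qed.

Lemma card_span2_gtp {p : nat} (hp : p = 2%N \/ p = 3%N) (u v : Zp3 p) :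
  u != 0 -> v != 0 -> v != u -> v != - u -> (p < #|span2 u v|)%N.
Proof.
move=> u0 v0 vu vNu; rewrite -[ltnLHS](card_line hp u u0).
apply: proper_card; apply/properP; split.
  apply/subsetP => _ /imsetP[s _ ->].
  by have := mem_span2 u v s 0; rewrite scale0r addr0.
exists v; first by have := mem_span2 u v 0 1; rewrite scale1r scale0r add0r.
apply/imsetP => -[s _]; case: (scalar_cases hp s) => ->.
- by rewrite scale0r; apply/eqP.
- by rewrite scale1r; apply/eqP.
- by rewrite scaleN1r; apply/eqP.
Qed.

(** There are [#|B| * #|B|.-1] ordered pairs of distinct elements, and fewer
    nonzero values for their differences. *)
Lemma parallelogram {V : finZmodType} (B : {set V}) :
  (#|V| <= #|B| * #|B|.-1)%N ->
  exists x y z w, [/\ x \in B, y \in B, z \in B & w \in B] /\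
    [/\ x != y, (x, y) != (z, w) & x - y = z - w].
Proof.
move=> le_V; pose D := [set q in setX B B | q.1 != q.2].
pose f (q : V * V) := q.1 - q.2.
have cardD : #|D| = (#|B| * #|B|.-1)%N.
  have -> : D = setX B B :\: [set (x, x) | x in B].
    apply/setP => -[x y]; rewrite !inE /=; apply/andP/andP => -[].
      move=> xyB xy; split=> //; apply/imsetP => -[z zB [xz yz]].
      by rewrite xz yz eqxx in xy.
    move=> /imsetP xy /andP[xB yB]; split; first by rewrite xB.
    by apply/eqP => exy; apply: xy; exists x; rewrite // exy.
  rewrite cardsD cardsX (setIidPr _) ?card_imset.
  - by case: #|B| => // n; rewrite mulnS addKn.
  - by move=> x y [].
  - by apply/subsetP => _ /imsetP[x xB ->]; rewrite inE /= xB.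
have /dinjectivePn[[x y] xyD [[z w]]] : ~~ dinjectiveb f D.
  apply/dinjectiveP => f_inj.
  have : (#|f @: D| < #|[set: V]|)%N.
    apply: proper_card; apply/properP; split; first exact: subsetT.
    exists 0; rewrite ?inE //; apply/imsetP => -[[x y]]; rewrite inE /f /=.
    by move=> /andP[_ /negP xy] /esym/eqP; rewrite subr_eq0.
  by rewrite card_in_imset // cardD cardsT ltnNge le_V.
move: xyD; rewrite !inE /f /= => /andP[/andP[xB yB] xy].
move=> /andP[zwxy /andP[/andP[zB wB] zw]] e.
by exists x, y, z, w; split; split; rewrite // eq_sym.
Qed.

(** Two equal differences [x - y = z - w] of [B] either bound a parallelogram,
    whose two sides and two diagonals are differences of [B], or extend one
    another along a line, as in [x - y = y - w] (with [w = x] possible when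
    [(x - y) *+ 2 = 0]). In the latter case any other point [s] of [B] gives the
    differences [u], [v], [u + v] and [u - v], where [u] is the step [x - y] and
    [v] is [s - y]. The set [S] stands for any set that contains all the
    differences of [B]. *)
Lemma plane_of_differences {V : finZmodType} (B : {set V}) :
  (#|V| <= #|B| * #|B|.-1)%N -> (3 < #|B|)%N ->
  exists u v,
    [/\ u != 0, v != 0, v != u & v != - u] /\
    (forall S : {set V}, {in B &, forall b c, b - c \in S} ->
      [/\ u \in S, v \in S, u + v \in S & u - v \in S]).
Proof.
move=> B_large B_gt3.
have collinear (x y w : V) : x \in B -> y \in B -> w \in B -> x != y ->
    x - y = y - w -> exists u v,
    [/\ u != 0, v != 0, v != u & v != - u] /\
    (forall S : {set V}, {in B &, forall b c, b - c \in S} ->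
      [/\ u \in S, v \in S, u + v \in S & u - v \in S]).
  move=> xB yB wB xy e.
  have /subsetPn[s sB] : ~~ (B \subset x |: [set y; w]).
    apply/negP => /subset_leq_card; rewrite cardsU1 cards2; lia.
  rewrite !inE !negb_or => /and3P[sx sy sw]; exists (x - y), (s - y).
  split; first split; rewrite ?subr_eq0 ?(inj_eq (addIr _)) //.
    by rewrite e opprB (inj_eq (addIr _)).
  move=> S BS; split; [exact: BS|exact: BS| |].
    by rewrite e addrC addrA subrK BS.
  by rewrite opprB addrA subrK BS.
have [x [y [z [w [[xB yB zB wB] [xy xyzw e]]]]]] := parallelogram B B_large.
case: (eqVneq y z) => [yz|yz]; first by apply: (collinear x y w); rewrite // e yz.
case: (eqVneq x w) => [xw|xw].
  apply: (collinear z w y) => //; last by rewrite -e xw.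
  by rewrite -subr_eq0 -e subr_eq0.
have e' : x - z = y - w.
  by rewrite -[x](subrK y) e -addrA addrC addrA subrK.
exists (x - y), (x - z); split; first split; rewrite ?subr_eq0 //.
- apply: contraNneq xyzw => xz; apply/eqP; congr (_, _) => //.
  by apply/eqP; rewrite -subr_eq0 -e' xz subrr.
- by rewrite (inj_eq (addrI _)) eqr_opp eq_sym.
- by rewrite opprB e' (inj_eq (addrI _)) eqr_opp eq_sym.
move=> S BS; split; [exact: BS|exact: BS| |].
  by rewrite e' addrA subrK BS.
by rewrite opprB addrC addrA subrK BS.
Qed.

(** The [#|B| * p] sums [b + s *: xi] cannot all be distinct, and a coincidence
    makes [xi] or [- xi] a difference of [B]. *)
Lemma zeros_setT_of_card {R : realType} {p : nat} (hp : p = 2%N \/ p = 3%N)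
    (E B : {set Zp3 p}) : {in B &, forall b c, b - c \in zeros R E} ->
  (p ^ 2 < #|B|)%N -> zeros R E = [set: Zp3 p].
Proof.
move=> BE B_gt; apply/eqP; rewrite eqEsubset subsetT; apply/subsetP => xi _.
have p_gt1 : (1 < p)%N by lia.
pose f (q : Zp3 p * 'Z_p) := q.1 + q.2 *: xi.
have /dinjectivePn[[b s] bs [[c t]]] : ~~ dinjectiveb f (setX B [set: 'Z_p]).
  apply/dinjectiveP => f_inj.
  have : (#|f @: setX B [set: 'Z_p]| <= #|[set: Zp3 p]|)%N.
    by rewrite subset_leq_card // subsetT.
  rewrite card_in_imset // cardsX card_scalars // card_Zp3 // expnSr.
  by rewrite leq_pmul2r ?(ltnW p_gt1) // leqNgt B_gt.
move: bs; rewrite !inE /f /= !andbT => bB /andP[ct cB] e.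
have e' : c - b = (s - t) *: xi.
  by rewrite scalerBl; apply/eqP; rewrite subr_eq addrAC eq_sym subr_eq addrC e.
case: (scalar_cases hp (s - t)) e' => st; rewrite st => e'.
- move: e' ct; rewrite scale0r => /eqP; rewrite subr_eq0 => /eqP ->.
  by move/eqP: st; rewrite subr_eq0 => /eqP ->; rewrite eqxx.
- by have := BE _ _ cB bB; rewrite e' scale1r inE.
- by have := BE _ _ cB bB; rewrite e' scaleN1r zerosN // inE.
Qed.

Lemma group_spectrum_of_spectral {R : realType} {p : nat}
    (hp : p = 2%N \/ p = 3%N) (E : {set Zp3 p}) (E_neq0 : E != set0) :
  spectral R E -> exists W, group_spectrum R E W.
Proof.
have p_gt1 : (1 < p)%N by lia.
have p_pr : prime p by case: hp => ->.
move/spectral_fourier => []// B cardB B_zero.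
have BE : {in B &, forall b c, b - c \in zeros R E}.
  move=> b c bB cB; rewrite inE subr_eq0; case: eqVneq => //= bc.
  by rewrite B_zero.
have E_gt0 : (0 < #|E|)%N by rewrite card_gt0.
have [E_le1|E_gt1] := leqP #|E| 1.
  by exists [set 0]; apply: group_spectrum1; lia.
have [b [c [bB cB bc]]] : exists b c, [/\ b \in B, c \in B & b != c].
  by apply/card_gt1P; rewrite cardB.
pose L := span2 (b - c) 0.
have L_zmod : zmod_closed L := span2_zmod_closed _ _.
have L_gt : (p ^ 0 < #|L|)%N by rewrite card_span2_gt1 // subr_eq0.
have LE : L \subset zeros R E.
  by apply: span2_sub_zeros; rewrite ?subr0 ?addr0 ?zeros0 ?BE.
have [E_lep|E_gtp] := leqP #|E| p.
  by exists L; apply: (group_spectrum_of_card p_pr 0).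
have p_dvd : (p %| #|E|)%N.
  apply: dvdn_trans (card_subgroup_dvd R p_gt1 E L L_zmod LE).
  exact: (dvdn_card_subgroup R p_pr 0).
have E_ge2p : (2 * p <= #|E|)%N.
  case/dvdnP: p_dvd E_gtp => m ->.
  by rewrite -{1}(mul1n p) ltn_pmul2r ?leq_pmul2r; lia.
have [E_lep2|E_gtp2] := leqP #|E| (p ^ 2).
  have B_large : (#|{: Zp3 p}| <= #|B| * #|B|.-1)%N.
    rewrite -cardsT card_Zp3 // cardB; apply: (@leq_trans (2 * p * (2 * p).-1)).
      by case: hp => ->.
    by apply: leq_mul => //; lia.
  have B_gt3 : (3 < #|B|)%N by rewrite cardB; lia.
  have [u [v [[u0 v0 vu vNu] uvE]]] := plane_of_differences B B_large B_gt3.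
  have [uE vE uDvE uBvE] := uvE _ BE.
  exists (span2 u v); apply: (group_spectrum_of_card p_pr 1) => //.
  - exact: span2_zmod_closed.
  - exact: span2_sub_zeros.
  - by rewrite expn1 card_span2_gtp.
exists [set: Zp3 p]; apply: (group_spectrum_of_card p_pr 2) => //.
- exact: setT_zmod_closed.
- by rewrite (zeros_setT_of_card hp E B) // cardB.
- by rewrite card_Zp3 // ltn_exp2l.
- by rewrite -(card_Zp3 p_gt1) subset_leq_card // subsetT.
Qed.

(** * From a tiling to a subgroup of zeros *)

Lemma tiles_sum {p : nat} (E : {set Zp3 p}) : tiles E ->
  exists A : {set Zp3 p}, forall (V : nmodType) (F : Zp3 p -> V),
    \sum_(g in [set: Zp3 p]) F g = \sum_(a in A) \sum_(x in E) F (x + a).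
Proof.
move=> [A [A_inj /and3P[/eqP coverE triv _]]]; exists A => V F.
rewrite -coverE big_trivIset // big_imset //=; apply: eq_bigr => a _.
by rewrite big_imset // => x y _ _ /addIr.
Qed.

Lemma fourier_setT {R : realType} {p : nat} (p_gt1 : (1 < p)%N) (xi : Zp3 p) :
  xi != 0 -> fourier R [set: Zp3 p] xi = 0.
Proof.
move=> xi0; rewrite /fourier; under eq_bigr => x _ do rewrite dotC.
rewrite sum_chi_subgroup //; last exact: setT_zmod_closed.
by rewrite annihilatorT (negPf xi0) muln0.
Qed.

(** The Fourier transform of the constant function [1], which is the convolution
    of the indicators of [E] and [A], is the product of theirs. *)
Lemma tiles_fourier {R : realType} {p : nat} (p_gt1 : (1 < p)%N)
    (E : {set Zp3 p}) : tiles E ->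
  exists2 A : {set Zp3 p}, (#|E| * #|A|)%N = (p ^ 3)%N &
    forall xi, (xi \in zeros R E) || (xi \in zeros R A).
Proof.
move/tiles_sum => [A sumEA]; exists A.
  have := sumEA nat (fun=> 1%N); rewrite sum1_card card_Zp3 // => ->.
  rewrite (eq_bigr (fun=> #|E|)) => [|a _]; last by rewrite sum1_card.
  by rewrite sum_nat_const mulnC.
move=> xi; rewrite !inE; case: (eqVneq xi 0) => //= xi0; rewrite -mulf_eq0.
have := sumEA _ (fun x => chi R (dot xi x)).
rewrite -/(fourier R setT xi) fourier_setT // => /esym EA0.
rewrite /fourier mulr_sumr; apply/eqP; apply: etrans EA0; apply: eq_bigr => a _.
rewrite mulr_suml; apply: eq_bigr => x _.
by rewrite (dotC xi (x + a)) dotDl chiD // !(dotC xi).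
Qed.

(** Two of the at most three unit vectors being summed are equal, and the
    remaining one is too short to cancel them. *)
Lemma fourier_neq0 {R : realType} {p : nat} (A : {set Zp3 p}) (a b xi : Zp3 p) :
  (#|A| <= 3)%N -> a \in A -> b \in A -> a != b -> dot xi a = dot xi b ->
  fourier R A xi != 0.
Proof.
move=> A_le3 aA bA ab xi_ab.
rewrite /fourier (bigD1 a) //= (bigD1 b) /=; last by rewrite bA eq_sym.
rewrite xi_ab addrA; set S := (X in _ + X).
have S_le1 : `|S| <= 1.
  apply: le_trans (ler_norm_sum _ _ _) _.
  rewrite (eq_bigr (fun=> 1)) => [|x _]; last exact: normr_chi.
  have -> : 1 = 1%N%:R :> R[i] by [].
  rewrite -natr_sum ler_nat sum1_card.
  have cardD : (#|A :\ a :\ b| <= 1)%N.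
    move: A_le3; rewrite (cardsD1 a A) aA (cardsD1 b (A :\ a)) in_setD1.
    by rewrite bA eq_sym ab.
  apply: leq_trans cardD; apply/eq_leq/eq_card => x.
  by rewrite unfold_in !inE andbC [_ && (x \in A)]andbC.
apply/eqP => /eqP; rewrite addr_eq0 => /eqP/(congr1 Num.norm).
rewrite normrN -mulr2n normrMn normr_chi => S2.
by move: S_le1; rewrite -S2 (ler_nat _ 2 1).
Qed.

Lemma group_spectrum_of_tiles (R : realType) {p : nat}
    (hp : p = 2%N \/ p = 3%N) (E : {set Zp3 p}) (E_neq0 : E != set0) :
  tiles E -> exists W, group_spectrum R E W.
Proof.
have p_gt1 : (1 < p)%N by lia.
have p_pr : prime p by case: hp => ->.
move/(tiles_fourier (R := R) p_gt1) => [A cardEA EA].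
have E_gt0 : (0 < #|E|)%N by rewrite card_gt0.
have : (#|E| %| p ^ 3)%N by rewrite -cardEA dvdn_mulr.
move/(dvdn_pfactor _ _ p_pr) => [k k_le3 cardE].
have cardA : #|A| = (p ^ (3 - k))%N.
  by apply/eqP; rewrite -(eqn_pmul2l E_gt0) cardEA cardE -expnD subnKC.
case: k k_le3 cardE cardA => [|[|[|[|//]]]] _ cardE cardA.
- by exists [set 0]; apply: group_spectrum1.
- have [xi xiE xi0] : exists2 xi, xi \in zeros R E & xi != 0.
    apply/exists_inP/contraT; rewrite negb_exists_in => /forall_inP E_only0.
    have A_all : [set: Zp3 p] \subset zeros R A.
      apply/subsetP => xi _; have /orP[xiE|//] := EA xi.
      by have := E_only0 _ xiE; rewrite negbK => /eqP ->; exact: zeros0.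
    have := card_subgroup_dvd R p_gt1 A _ setT_zmod_closed A_all.
    by rewrite card_Zp3 // cardA dvdn_Pexp2l.
  exists (span2 xi 0); apply: (group_spectrum_of_card p_pr 0) => //.
  + exact: span2_zmod_closed.
  + by apply: span2_sub_zeros; rewrite ?subr0 ?addr0 ?zeros0.
  + by rewrite card_span2_gt1.
  + by rewrite cardE.
- have /card_gt1P[a [b [aA bA ab]]] : (1 < #|A|)%N by rewrite cardA.
  pose L := span2 (a - b) 0; have L_zmod : zmod_closed L := span2_zmod_closed _ _.
  exists (annihilator L); apply: (group_spectrum_of_card p_pr 1) => //.
  + exact: annihilator_zmod_closed.
  + apply/subsetP => w; rewrite inE => /forall_inP/(_ _ (mem_span2l _ _)).
    rewrite dotBl subr_eq0 !(dotC _ w) => /eqP w_ab.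
    have /orP[//|] := EA w; rewrite !inE => /orP[-> //|].
    by rewrite (negPf (fourier_neq0 A a b w _ aA bA ab w_ab)) // cardA; lia.
  + have L_le : (#|L| <= p)%N.
      rewrite -[leqRHS](card_line hp (a - b)) ?subr_eq0 //.
      apply: subset_leq_card; apply/subsetP => _ /imset2P[s t _ _ ->].
      by rewrite scaler0 addr0; apply/imsetP; exists s.
    have L_gt0 : (0 < #|L|)%N by apply/card_gt0P; exists (a - b); exact: mem_span2l.
    rewrite -(ltn_pmul2l L_gt0) (card_annihilator R) // expn1.
    apply: (@leq_ltn_trans (p * p)); first by rewrite leq_mul2r L_le orbT.
    by rewrite -(expnD p 1 1) ltn_exp2l.
  + by rewrite cardE.
- have EsetT : E = [set: Zp3 p].
    by apply/eqP; rewrite eqEcard subsetT card_Zp3 // cardE /=.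
  exists [set: Zp3 p]; split; last by rewrite EsetT.
    exact: setT_zmod_closed.
  apply/subsetP => xi _; rewrite inE; case: eqVneq => //= xi0.
  by rewrite EsetT fourier_setT.
Qed.

Theorem theorem9p2 (R : realType) (p : nat) (hp : p = 2%N \/ p = 3%N)
    (E : {set Zp3 p}) (hE : E != set0) :
  spectral R E <-> tiles E.
Proof.
have p_gt1 : (1 < p)%N by lia.
split=> [spE | tilE].
  have [W EW] := group_spectrum_of_spectral hp E hE spE.
  exact: tiles_of_group_spectrum EW.
have [W EW] := group_spectrum_of_tiles R hp E hE tilE.
exact: spectral_of_group_spectrum EW.
Qed.
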